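(* Let $(\omega,\Omega)$ be a regular almost-cosymplectic-contact structure on $M$ with dual pair $(E,\Lambda)$. A vector field $X$ on $M$ is an infinitesimal symmetry of $\Lambda$, i.e. $L_X\Lambda=[X,\Lambda]=0$, if and only if $X=X_{(\alpha,h)}$ for a 1-form $\alpha$ and a function $h\in C^\infty(M)$ satisfying $$[\alpha^\sharp,\Lambda]-E\wedge(dh+h\,L_E\omega)^\sharp=0.$$
   Context: $M$ is a smooth manifold of dimension $2n+1$; everything is smooth. A regular almost-cosymplectic-contact structure on $M$ is a pair $(\omega,\Omega)$ of a 1-form $\omega$ and a 2-form $\Omega$ with $d\Omega=0$ and $\omega\wedge\Omega^n$ nowhere zero. Write $\Omega^\flat:TM\to T^*M$, $Y\mapsto Y^\flat=i_Y\Omega$, and for a bivector field $\Lambda$ write $\Lambda^\sharp:T^*M\to TM$, $\alpha\mapsto\alpha^\sharp=i_\alpha\Lambda$, i.e. $\beta(\alpha^\sharp)=\Lambda(\alpha,\beta)$. The dual pair $(E,\Lambda)$ is the unique pair of a vector field $E$ (the Reeb vector field) and a bivector field $\Lambda$ such that $(\Omega^\flat|_{\mathrm{Im}\,\Lambda^\sharp})^{-1}=\Lambda^\sharp|_{\mathrm{Im}\,\Omega^\flat}$, $i_E\omega=1$, $i_E\Omega=0$, $i_\omega\Lambda=0$. For a 1-form $\alpha$ and a function $h$ put $X_{(\alpha,h)}=\alpha^\sharp+hE$. Every vector field is of this form, with $h=\omega(X)$ and $\alpha$ determined up to adding a function multiple of $\omega$. $L$ denotes the Lie derivative. $[\,,]$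 is the Schouten–Nijenhuis bracket; for a vector field $X$ one has $[X,\Lambda]=L_X\Lambda$. For vector fields $Y,Z$: $(Y\wedge Z)(\beta,\gamma)=\beta(Y)\gamma(Z)-\beta(Z)\gamma(Y)$. *)

(* Defs.v *)
From HB Require Import structures.
From mathcomp Require Import all_boot all_order all_algebra all_fingroup.
From mathcomp Require Import all_classical all_reals all_analysis.
Set Implicit Arguments.
Unset Strict Implicit.
Unset Printing Implicit Defensive.
Import Order.TTheory GRing.Theory Num.Theory.
Import numFieldNormedType.Exports.
Local Open Scope classical_set_scope.
Local Open Scope ring_scope.

(* f is of class C^k on U; meant for open U in a finite-dimensional V, where
   "all 'D_v f are C^k" is the same as "the differential of f is C^k". *)
Fixpoint class_C (R : realType) (V W : normedModType R) (k : nat) (U : set V)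
    (f : V -> W) : Prop :=
  if k is k'.+1 then
    (forall x, U x -> differentiable f x) /\
    (forall v : V, class_C k' U (fun x => 'D_v f x))
  else forall x, U x -> {for x, continuous f}.

Definition smooth_on (R : realType) (V W : normedModType R) (U : set V)
    (f : V -> W) : Prop :=
  forall k, class_C k U f.

(* A smooth manifold of dimension m, given by a smooth atlas. The chart i is
   the homeomorphism fwd i from the open set dom i onto the open set
   fwd i @` dom i of R^m, with inverse bwd i; the values of fwd i and bwd i
   outside these sets are irrelevant. The function chart_at chooses a chart
   around each point; in particular the charts cover. *)
Record smoothManifold (R : realType) (m : nat) := SmoothManifold {
  point_of :> topologicalType;
  chart : Type;
  dom : chart -> set point_of;
  fwd : chart -> point_of -> 'rV[R]_m;
  bwd : chart -> 'rV[R]_m -> point_of;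
  chart_at : point_of -> chart;
  manifold_hausdorff : hausdorff_space point_of;
  manifold_second_countable : @second_countable point_of;
  dom_open : forall i, open (dom i);
  codom_open : forall i, open (fwd i @` dom i);
  fwdK : forall i p, dom i p -> bwd i (fwd i p) = p;
  fwd_continuous : forall i p, dom i p -> {for p, continuous (fwd i)};
  bwd_continuous : forall i x,
    (fwd i @` dom i) x -> {for x, continuous (bwd i)};
  dom_chart_at : forall p, dom (chart_at p) p;
  transition_smooth : forall i j,
    smooth_on (fwd i @` (dom i `&` dom j)) (fwd j \o bwd i)
}.

Section Fields.
Context {R : realType} {m : nat} {M : smoothManifold R m}.

(* The tangent space at p is identified with R^m (row vectors) through the
   coordinates of chart_at p, and the tensors at p accordingly:
     - a tangent vector is a row v;
     - a covector is a row b, with b(v) = pairing b v;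
     - a bilinear form on tangent vectors is a matrix W, with
       W(u, v) = u W v^T, and likewise a bilinear form on covectors.
   So a field of tensors is a plain function on M; smoothness and derivatives
   are those of its components in the charts. *)
Definition vfield := M -> 'rV[R]_m.
Definition form1 := M -> 'rV[R]_m.
Definition form2 := M -> 'M[R]_m.
Definition bivector := M -> 'M[R]_m.

Definition pairing (b v : 'rV[R]_m) : R := (b *m v^T) 0 0.
Definition bilin (W : 'M[R]_m) (u v : 'rV[R]_m) : R := (u *m W *m v^T) 0 0.

(* Change of coordinates at q from chart i to chart j: a vector with
   components u in chart i has components u *m trans i j q in chart j. *)
Definition trans (i j : chart M) (q : M) : 'M[R]_m :=
  'J (fwd j \o bwd i) (fwd i q).

(* Components in chart i, as functions of the coordinates of chart i.
   Covariant tensors are pulled back along the change from i to chart_at q. *)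
Definition fun_in (i : chart M) (h : M -> R) (x : 'rV[R]_m) : R :=
  h (bwd i x).
Definition vfield_in (i : chart M) (X : vfield) (x : 'rV[R]_m) : 'rV[R]_m :=
  let q := bwd i x in X q *m trans (chart_at q) i q.
Definition form1_in (i : chart M) (b : form1) (x : 'rV[R]_m) : 'rV[R]_m :=
  let q := bwd i x in b q *m (trans i (chart_at q) q)^T.
Definition form2_in (i : chart M) (W : form2) (x : 'rV[R]_m) : 'M[R]_m :=
  let q := bwd i x in
  trans i (chart_at q) q *m W q *m (trans i (chart_at q) q)^T.
Definition bivector_in (i : chart M) (L : bivector) (x : 'rV[R]_m) :
    'M[R]_m :=
  let q := bwd i x in
  (trans (chart_at q) i q)^T *m L q *m trans (chart_at q) i q.

Definition smooth_fun (h : M -> R) : Prop :=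
  forall i : chart M, smooth_on (fwd i @` dom i) (fun_in i h : _ -> R^o).
Definition smooth_vfield (X : vfield) : Prop :=
  forall i : chart M, smooth_on (fwd i @` dom i) (vfield_in i X).
Definition smooth_form1 (b : form1) : Prop :=
  forall i : chart M, smooth_on (fwd i @` dom i) (form1_in i b).
Definition smooth_form2 (W : form2) : Prop :=
  (forall p, (W p)^T = - W p) /\
  forall i : chart M, smooth_on (fwd i @` dom i) (form2_in i W).
Definition smooth_bivector (L : bivector) : Prop :=
  (forall p, (L p)^T = - L p) /\
  forall i : chart M, smooth_on (fwd i @` dom i) (bivector_in i L).

(* Y^flat = W(Y, -) and b(a^sharp) = L(a, b). *)
Definition flat_at (W : 'M[R]_m) (v : 'rV[R]_m) : 'rV[R]_m := v *m W.
Definition sharp_at (L : 'M[R]_m) (a : 'rV[R]_m) : 'rV[R]_m := a *m L.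
Definition sharp (L : bivector) (a : form1) : vfield :=
  fun p => sharp_at (L p) (a p).

(* (Y /\ Z)(b, c) = b(Y) c(Z) - b(Z) c(Y) *)
Definition wedge_vfield (Y Z : vfield) : bivector :=
  fun p => (Y p)^T *m Z p - (Z p)^T *m Y p.

(* The components, in chart_at p, of the differentials at p. *)
Definition dfun (h : M -> R) : form1 := fun p =>
  let i := chart_at p in
  \row_k 'D_(delta_mx 0 k) (fun_in i h : _ -> R^o) (fwd i p).

(* (dW)_abc = d_a W_bc + d_b W_ca + d_c W_ab *)
Definition dform2 (W : form2) (p : M) (a b c : 'I_m) : R :=
  let i := chart_at p in
  let D k := 'D_(delta_mx 0 k) (form2_in i W) (fwd i p) in
  D a b c + D b c a + D c a b.

(* Lie derivatives along X, in the coordinates x^a of chart_at p: they are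
   given by L_X f = X f on functions, L_X dx^a = d(X^a) and the Leibniz rule
   (for L : L_X(L(b, c)) = (L_X L)(b, c) + L(L_X b, c) + L(b, L_X c)), so
     (L_X b)_a  = X^k d_k b_a + b_k d_a X^k,
     (L_X L)^ab = X^k d_k L^ab - L^kb d_k X^a - L^ak d_k X^b.
   Here ('J X)_ka = d_k X^a. *)
Definition lie_form1 (X : vfield) (b : form1) : form1 := fun p =>
  let i := chart_at p in
  let x := fwd i p in
  'D_(vfield_in i X x) (form1_in i b) x
  + form1_in i b x *m ('J (vfield_in i X) x)^T.

Definition lie_bivector (X : vfield) (L : bivector) : bivector := fun p =>
  let i := chart_at p in
  let x := fwd i p in
  'D_(vfield_in i X x) (bivector_in i L) x
  - ('J (vfield_in i X) x)^T *m bivector_in i L x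
  - bivector_in i L x *m 'J (vfield_in i X) x.

(* The Schouten-Nijenhuis bracket of a vector field and a bivector field. *)
Definition schouten (X : vfield) (L : bivector) : bivector :=
  lie_bivector X L.

Definition field_Xah (E : vfield) (L : bivector) (a : form1) (h : M -> R) :
    vfield :=
  fun p => sharp L a p + h p *: E p.

End Fields.
Arguments vfield {R m} M.
Arguments form1 {R m} M.
Arguments form2 {R m} M.
Arguments bivector {R m} M.

Section Exterior.
Context {R : realType} {V : Type}.

(* Exterior forms of degree k at a point, as functions of k vectors. *)
Definition ext (k : nat) := ('I_k -> V) -> R.

Definition wedge (k l : nat) (f : ext k) (g : ext l) : ext (k + l) := fun v =>
  (k`!%:R * l`!%:R)^-1 *
  \sum_(s : 'S_(k + l))
     (-1) ^+ s * f (fun i => v (s (lshift l i))) *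
                 g (fun j => v (s (rshift k j))).

Fixpoint wedge_pow (f : ext 2) (n : nat) : ext n.*2 :=
  match n return ext n.*2 with
  | 0 => fun=> 1
  | n'.+1 => wedge f (@wedge_pow f n')
  end.

End Exterior.
Arguments wedge_pow {R V} f n.

Section AlmostCosymplecticContact.
Context {R : realType} {n : nat} {M : smoothManifold R n.*2.+1}.

Definition omega_wedge_Omega_pow (w : form1 M) (W : form2 M) (p : M) :
    @ext R 'rV[R]_n.*2.+1 n.*2.+1 :=
  wedge (fun v : 'I_1 -> _ => pairing (w p) (v 0))
        (wedge_pow (fun v : 'I_2 -> _ => bilin (W p) (v 0) (v 1)) n).

(* Regular almost-cosymplectic-contact structure. *)
Record regular_acc (w : form1 M) (W : form2 M) : Prop := {
  acc_smooth1 : smooth_form1 w;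
  acc_smooth2 : smooth_form2 W;
  acc_closed : forall p a b c, dform2 W p a b c = 0;
  acc_volume : forall p, exists v, omega_wedge_Omega_pow w W p v != 0
}.

(* The two cancellation properties say that, at each point, flat restricts to
   a bijection from the image of sharp onto the image of flat, whose inverse
   is the restriction of sharp. *)
Record dual_pair (w : form1 M) (W : form2 M) (E : vfield M) (L : bivector M) :
    Prop := {
  dual_smoothE : smooth_vfield E;
  dual_smoothL : smooth_bivector L;
  dual_flatK : forall p,
    {in range (sharp_at (L p)), cancel (flat_at (W p)) (sharp_at (L p))};
  dual_sharpK : forall p,
    {in range (flat_at (W p)), cancel (sharp_at (L p)) (flat_at (W p))};
  dual_Ew : forall p, pairing (w p) (E p) = 1;
  dual_EW : forall p, flat_at (W p) (E p) = 0;
  dual_wL : forall p, sharp_at (L p) (w p) = 0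
}.

End AlmostCosymplecticContact.

(* Main.v *)
Require Import Defs.
From mathcomp Require Import all_boot all_order all_algebra fingroup perm.
From mathcomp Require Import all_classical all_reals all_analysis.
From mathcomp Require Import ring.

(** The Leibniz rule for a field X = alpha^sharp + h E reads
      L_X L = [alpha^sharp, L] + h L_E L - E /\ (dh)^sharp
    ([lie_bivector_scale]), and the Reeb field satisfies
      L_E L = - E /\ (L_E omega)^sharp
    ([lie_reeb]). Hence L_X L is exactly the bivector field in the condition on
    (alpha, h) ([lie_field_Xah]), and the equivalence reduces to the fact that
    every smooth X is alpha^sharp + h E with alpha = i_X Omega and
    h = omega(X), both smooth.

    Everything rests on the pointwise identity, in row-vector notation,
      Omega L = 1 - omega^T E
    ([flat_sharpE]): applied to X it is the decomposition above, and its Lie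
    derivative along E, together with that of omega L = 0 and with
    L_E Omega = 0 ([lie_closed_form2], from d Omega = 0 and i_E Omega = 0),
    yields the formula for L_E L. The identity holds because a vector killed
    by omega and Omega would kill the volume form omega /\ Omega^n, and a form
    of top degree killed by a nonzero vector vanishes ([killed_top_form]).

    The Lie derivatives at p are computed in the chart chosen at p, so these
    identities are needed on a neighbourhood of p, where the components in
    that chart differ from the stored ones by transition matrices; the chain
    rule [transK] makes the identities independent of the chart. *)

Set Implicit Arguments.
Unset Strict Implicit.
Import Order.TTheory GRing.Theory Num.Theory.
Import numFieldNormedType.Exports.
Local Open Scope classical_set_scope.
Local Open Scope ring_scope.

(** * Calculus of matrix-valued functions *)

Section MatrixCalculus.
Context {R : realType} {V : normedModType R}.

(** A matrix is the sum of its entries times the elementary matrices, so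
    the calculus of matrix-valued functions reduces to that of real ones. *)
Lemma differentiable_mxP {a b : nat} (F : V -> 'M[R]_(a, b)) (x : V) :
  differentiable F x <-> forall i j, differentiable (fun y => F y i j) x.
Proof.
split=> [dF i j|dF].
  apply: (@differentiable_comp _ _ _ _ F (fun N : 'M[R]_(a, b) => N i j)) => //.
  exact: differentiable_coord.
have -> : F = (fun y => \sum_i (\sum_j (fun y => F y i j *: delta_mx i j)) y).
  apply/funext => y; rewrite {1}[F y]matrix_sum_delta.
  by apply: eq_bigr => i _; rewrite fct_sumE.
rewrite -fct_sumE; apply: differentiable_sum => i; apply: differentiable_sum => j.
exact: differentiableZl.
Qed.

Lemma differentiable_trmx {a b : nat} (F : V -> 'M[R]_(a, b)) (x : V) :
  differentiable F x -> differentiable (fun y => (F y)^T) x.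
Proof.
move=> /differentiable_mxP dF; apply/differentiable_mxP => i j.
by under eq_fun do rewrite mxE.
Qed.

Lemma differentiable_mulmx {a b c : nat} (F : V -> 'M[R]_(a, b))
    (G : V -> 'M[R]_(b, c)) (x : V) :
  differentiable F x -> differentiable G x ->
  differentiable (fun y => F y *m G y) x.
Proof.
move=> /differentiable_mxP dF /differentiable_mxP dG.
apply/differentiable_mxP => i j.
under eq_fun do rewrite mxE.
rewrite -fct_sumE; apply: differentiable_sum => k.
exact: differentiableM.
Qed.

Lemma derive_mxE {a b : nat} (F : V -> 'M[R]_(a, b)) (x v : V) i j :
  differentiable F x -> ('D_v F x) i j = 'D_v (fun y => F y i j) x.
Proof. by move=> dF; rewrite derive_mx ?mxE //; exact: diff_derivable. Qed.

Lemma derive_trmx {a b : nat} (F : V -> 'M[R]_(a, b)) (x v : V) :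
  differentiable F x -> 'D_v (fun y => (F y)^T) x = ('D_v F x)^T.
Proof.
move=> dF; apply/matrixP => i j.
rewrite mxE !derive_mxE //; last exact: differentiable_trmx.
by under eq_fun do rewrite mxE.
Qed.

Lemma derive_mulmx {a b c : nat} (F : V -> 'M[R]_(a, b))
    (G : V -> 'M[R]_(b, c)) (x v : V) :
  differentiable F x -> differentiable G x ->
  'D_v (fun y => F y *m G y) x = 'D_v F x *m G x + F x *m 'D_v G x.
Proof.
move=> dF dG; apply/matrixP => i j.
rewrite derive_mxE; last exact: differentiable_mulmx.
have dFe : forall k, derivable (fun y => F y i k) x v.
  by move=> k; apply: diff_derivable; have /differentiable_mxP := dF.
have dGe : forall k, derivable (fun y => G y k j) x v.
  by move=> k; apply: diff_derivable; have /differentiable_mxP := dG.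
under eq_fun do rewrite mxE.
rewrite -fct_sumE derive_sum; last by move=> k; exact: derivableM.
rewrite !mxE -big_split; apply: eq_bigr => k _ /=.
rewrite deriveM // !derive_mxE // addrC /GRing.scale /=.
by congr (_ + _); rewrite mulrC.
Qed.

End MatrixCalculus.

(** * Functions of class C^k *)
Section ClassC.
Context {R : realType} {V : normedModType R}.

(** Formulas for derivatives hold only on the open set where the functions
    are smooth; iterating them requires that differentiability depend on the
    germ alone. *)
Lemma near_eq_differentiable {W : normedModType R} (f g : V -> W) (x : V) :
  {near x, f =1 g} -> differentiable f x -> differentiable g x.
Proof.
move=> fg df; have fgx : f x = g x by exact: (nbhs_singleton fg).
have dgE : g \o shift x = cst (g x) + 'd f x +o_ 0 id.
  apply/eqaddoP => e e0.
  have /eqaddoP/(_ e e0) := diff_locally df.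
  apply: filter_app.
  have : \forall y \near 0, f (y + x) = g (y + x).
    move: fg; rewrite (near_shift 0) /=.
    by apply: filterS => y /=; rewrite subr0.
  apply: filterS => y /= fgy.
  by rewrite ![in X in X -> _]fctE /= ![in X in _ -> X]fctE /= fgy fgx.
apply/diff_locallyP; rewrite (diff_unique (diff_continuous df) dgE); split => //.
exact: diff_continuous.
Qed.

Variable U : set V.
Hypothesis Uopen : open U.

Lemma near_eq_on {W : Type} (f g : V -> W) (x : V) :
  (forall y, U y -> f y = g y) -> U x -> {near x, f =1 g}.
Proof.
move=> fg Ux; apply: (filterS fg).
by apply: open_nbhs_nbhs; split.
Qed.

Lemma class_C_eq {W : normedModType R} k (f g : V -> W) :
  (forall x, U x -> f x = g x) -> class_C k U f -> class_C k U g.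
Proof.
elim: k f g => [|k IH] f g fg /=.
  move=> cf x Ux; have nfg := near_eq_on fg Ux.
  have : g @ x --> f x by exact: cvg_trans (near_eq_cvg nfg) (cf x Ux).
  by rewrite fg.
move=> [df Df]; split=> [x Ux|v].
  exact: near_eq_differentiable (near_eq_on fg Ux) (df x Ux).
apply: IH (Df v) => x Ux; apply: near_eq_derive; exact: near_eq_on fg Ux.
Qed.

Lemma class_CS {W : normedModType R} k (f : V -> W) :
  class_C k.+1 U f -> class_C k U f.
Proof.
elim: k f => [|k IH] f [df Df] /=.
  by move=> x Ux; apply: differentiable_continuous; exact: df.
by split=> // v; apply: IH; exact: Df.
Qed.

Lemma class_C_cst {W : normedModType R} k (c : W) : class_C k U (cst c : V -> W).
Proof.
elim: k c => [|k IH] c /=; first by move=> x _; exact: cst_continuous.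
split=> [x _|v]; first exact: differentiable_cst.
by apply: class_C_eq (IH 0) => x _; rewrite derive_cst.
Qed.

Lemma class_CD {W : normedModType R} k (f g : V -> W) :
  class_C k U f -> class_C k U g -> class_C k U (f + g).
Proof.
elim: k f g => [|k IH] f g /=.
  by move=> cf cg x Ux; apply: continuousD; [exact: cf|exact: cg].
move=> [df Df] [dg Dg]; split=> [x Ux|v].
  by apply: differentiableD; [exact: df|exact: dg].
apply: class_C_eq (IH _ _ (Df v) (Dg v)) => x Ux.
by rewrite deriveD //; apply: diff_derivable; [exact: df|exact: dg].
Qed.

(** The Leibniz rule expresses the derivatives of a product of class C^k+1
    through products of functions of class C^k. *)
Lemma class_CM k (f g : V -> R) :
  class_C k U f -> class_C k U g -> class_C k U (f * g).
Proof.
elim: k f g => [|k IH] f g.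
  by move=> cf cg x Ux; apply: continuousM; [exact: cf|exact: cg].
move=> Cf Cg; have [df Df] := Cf; have [dg Dg] := Cg; split=> [x Ux|v].
  by apply: differentiableM; [exact: df|exact: dg].
have fDg := IH _ _ (class_CS Cf) (Dg v).
have gDf := IH _ _ (class_CS Cg) (Df v).
apply: class_C_eq (class_CD fDg gDf) => x Ux.
by rewrite deriveM //; apply: diff_derivable; [exact: df|exact: dg].
Qed.

Lemma class_C_sum {W : normedModType R} k (I : Type) (r : seq I) (F : I -> V -> W) :
  (forall i, class_C k U (F i)) -> class_C k U (\sum_(i <- r) F i).
Proof.
by move=> CF; apply: big_ind => //; [exact: class_C_cst|exact: class_CD].
Qed.

Lemma class_C_mxP {a b : nat} k (F : V -> 'M[R]_(a, b)) :
  class_C k U F <-> forall i j, class_C k U (fun x => F x i j).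
Proof.
elim: k F => [|k IH] F.
  split=> [cF i j x Ux|cF].
    exact: (continuous_comp (cF x Ux) (@coord_continuous _ _ _ i j (F x))).
  have -> : F = \sum_i \sum_j (fun y => F y i j *: delta_mx i j).
    apply/funext => y; rewrite {1}[F y]matrix_sum_delta fct_sumE.
    by apply: eq_bigr => i _; rewrite fct_sumE.
  apply: (@class_C_sum _ 0) => i; apply: (@class_C_sum _ 0) => j x Ux.
  exact: cvgZr_tmp (cF i j x Ux).
split=> [[dF DF]|CF].
  move=> i j; split=> [x Ux|v].
    by move: i j; apply/differentiable_mxP; exact: dF.
  move: i j; have /IH DFe := DF v => i j.
  apply: class_C_eq (DFe i j) => x Ux.
  by rewrite derive_mxE //; exact: dF.
have dF : forall x, U x -> differentiable F x.
  by move=> x Ux; apply/differentiable_mxP => i j; have [+ _] := CF i j; exact.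
split=> // v; apply/IH => i j.
have [_ /(_ v)] := CF i j; apply: class_C_eq => x Ux.
by rewrite derive_mxE //; exact: dF.
Qed.

Lemma class_C_mulmx {a b c : nat} k (F : V -> 'M[R]_(a, b))
    (G : V -> 'M[R]_(b, c)) :
  class_C k U F -> class_C k U G -> class_C k U (fun x => F x *m G x).
Proof.
move=> /class_C_mxP CF /class_C_mxP CG; apply/class_C_mxP => i j.
under eq_fun do rewrite mxE.
rewrite -fct_sumE; apply: class_C_sum => l.
exact: class_CM.
Qed.

Lemma class_C_trmx {a b : nat} k (F : V -> 'M[R]_(a, b)) :
  class_C k U F -> class_C k U (fun x => (F x)^T).
Proof.
move=> /class_C_mxP CF; apply/class_C_mxP => i j.
by under eq_fun do rewrite mxE.
Qed.

End ClassC.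

(** * Top-degree exterior forms *)

Section ExteriorForms.
Context {R : realType} {V : lmodType R}.

Definition upd (k : nat) (v : 'I_k -> V) (i : 'I_k) (x : V) : 'I_k -> V :=
  fun j => if j == i then x else v j.

Definition multilinear (k : nat) (f : @ext R V k) : Prop :=
  forall v i c x y,
    f (upd v i (c *: x + y)) = c * f (upd v i x) + f (upd v i y).

Definition killed_by (u : V) (k : nat) (f : @ext R V k) : Prop :=
  forall v i, v i = u -> f v = 0.

Definition antisymmetric_form (k : nat) (f : @ext R V k) : Prop :=
  forall (t : 'S_k) v, f (fun j => v (t j)) = (-1) ^+ t * f v.

Lemma upd_lshift k l (s : 'S_(k + l)) (v : 'I_(k + l) -> V) (a : 'I_k) x :
  (fun j => upd v (s (lshift l a)) x (s (lshift l j)))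
    = upd (fun j => v (s (lshift l j))) a x.
Proof.
by apply/funext => j; rewrite /upd (inj_eq perm_inj) (inj_eq (@lshift_inj _ _)).
Qed.

Lemma upd_rshift k l (s : 'S_(k + l)) (v : 'I_(k + l) -> V) (a : 'I_l) x :
  (fun j => upd v (s (rshift k a)) x (s (rshift k j)))
    = upd (fun j => v (s (rshift k j))) a x.
Proof.
by apply/funext => j; rewrite /upd (inj_eq perm_inj) (inj_eq (@rshift_inj _ _)).
Qed.

Lemma upd_lrshift k l (s : 'S_(k + l)) (v : 'I_(k + l) -> V) (a : 'I_k) x :
  (fun j => upd v (s (lshift l a)) x (s (rshift k j)))
    = (fun j => v (s (rshift k j))).
Proof.
by apply/funext => j; rewrite /upd (inj_eq perm_inj) eq_rlshift.
Qed.

Lemma upd_rlshift k l (s : 'S_(k + l)) (v : 'I_(k + l) -> V) (a : 'I_l) x :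
  (fun j => upd v (s (rshift k a)) x (s (lshift l j)))
    = (fun j => v (s (lshift l j))).
Proof.
by apply/funext => j; rewrite /upd (inj_eq perm_inj) eq_lrshift.
Qed.

Lemma wedge_multilinear k l (f : @ext R V k) (g : @ext R V l) :
  multilinear f -> multilinear g -> multilinear (wedge f g).
Proof.
move=> mf mg v i c x y; rewrite /wedge mulrCA -mulrDr; congr (_ * _).
rewrite mulr_sumr -big_split /=; apply: eq_bigr => s _.
(* slot i is passed to f or to g, according to the block containing s^-1 i *)
rewrite -(permKV s i); case: (split_ordP ((s^-1)%g i)) => a ->.
  by rewrite !upd_lshift !upd_lrshift mf mulrDr !mulrDl !mulrA (mulrC _ c).
by rewrite !upd_rshift !upd_rlshift mg mulrDr !mulrA (mulrC _ c) !mulrA.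
Qed.

Lemma wedge_killed_by u k l (f : @ext R V k) (g : @ext R V l) :
  killed_by u f -> killed_by u g -> killed_by u (wedge f g).
Proof.
move=> uf ug v i vi; rewrite /wedge big1 ?mulr0 // => s _.
have {}vi : v (s ((s^-1)%g i)) = u by rewrite permKV.
case: (split_ordP ((s^-1)%g i)) vi => a -> vi.
  by rewrite (uf _ a) // mulr0 mul0r.
by rewrite (ug _ a) // mulr0.
Qed.

(** The sum over all permutations makes a wedge product antisymmetric even
    when its factors are not. *)
Lemma wedge_antisymmetric k l (f : @ext R V k) (g : @ext R V l) :
  antisymmetric_form (wedge f g).
Proof.
move=> t v; rewrite /wedge mulrCA; congr (_ * _).
rewrite mulr_sumr (reindex_inj (mulIg t^-1%g)) /=; apply: eq_bigr => s _.
rewrite odd_permM odd_permV signr_addb (mulrC ((-1) ^+ s)) -!mulrA.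
congr (_ * (_ * (f _ * g _))); apply/funext => j;
  by rewrite permM permKV.
Qed.

Lemma multilinear_sum k (f : @ext R V k) (I : Type) (r : seq I)
    (c : I -> R) (x : I -> V) v i :
  multilinear f ->
  f (upd v i (\sum_(j <- r) c j *: x j)) = \sum_(j <- r) c j * f (upd v i (x j)).
Proof.
move=> mf; elim: r => [|j r IH].
  have := mf v i (-1) 0 0; rewrite !big_nil scaler0 add0r mulN1r addNr.
  exact.
by rewrite !big_cons mf IH.
Qed.

Lemma antisymmetric_repeat k (f : @ext R V k) v i j :
  antisymmetric_form f -> i != j -> v i = v j -> f v = 0.
Proof.
move=> af ij vij; apply/eqP; rewrite -eqNr; apply/eqP; symmetry.
have := af (tperm i j) v; rewrite odd_tperm ij expr1 mulN1r => <-.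
congr f; apply/funext => l.
by case: tpermP => // ->.
Qed.

Lemma upd_id k (v : 'I_k -> V) i : upd v i (v i) = v.
Proof. by apply/funext => j; rewrite /upd; case: eqP => // ->. Qed.

End ExteriorForms.

(** On an m-dimensional space, a nonzero vector u is, up to a factor t that
    may vanish, a nontrivial combination c of any m vectors: invert their
    matrix, or take c in its kernel. Let c_i != 0 and replace the i-th vector
    by that combination: by linearity and antisymmetry the value of the form
    is multiplied by c_i, but it vanishes as the form is killed by u. *)
Lemma killed_top_form (R : realType) (m : nat) (f : @ext R 'rV[R]_m m) u :
  multilinear f -> antisymmetric_form f -> killed_by u f -> u != 0 ->
  forall v, f v = 0.
Proof.
move=> mf af uf u0 v; pose A : 'M[R]_m := \matrix_i v i.
have [c c0 cAu] : exists2 c : 'rV[R]_m, c != 0 & (c *m A <= u)%MS.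
  have [Au|] := boolP (A \in unitmx).
    exists (u *m invmx A); last by rewrite mulmxKV.
    apply: contra u0 => /eqP uA; by rewrite -(mulmxKV Au u) uA mul0mx.
  rewrite unitmxE unitfE negbK => /det0P[c c0 cA].
  by exists c => //; rewrite cA sub0mx.
have [t cA] := sub_rVP cAu.
have [i ci] : exists i, c 0 i != 0 by exact/rV0Pn.
have E : f (upd v i (c *m A)) = c 0 i * f v.
  rewrite mulmx_sum_row.
  under eq_bigr do rewrite rowK.
  rewrite multilinear_sum // (bigD1 i) //= upd_id big1 ?addr0 // => j ji.
  rewrite (antisymmetric_repeat af (i := i) (j := j)) ?mulr0 //.
    by rewrite eq_sym.
  by rewrite /upd eqxx (negPf ji).
have : c 0 i * f v = 0.
  rewrite -E cA -[_ *: u]addr0.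
  have u0f : f (upd v i 0) = 0.
    by have := @multilinear_sum _ _ _ f 'I_0 [::] (fun=> 0) (fun=> 0) v i mf;
       rewrite !big_nil.
  by rewrite mf u0f addr0 (uf _ i) ?mulr0 // /upd eqxx.
by move/eqP; rewrite mulf_eq0 (negPf ci) => /eqP.
Qed.

Section Rank.
Context {R : realType} {m : nat}.
Implicit Types (w u : 'rV[R]_m) (W : 'M[R]_m).

Lemma pairingE w u : pairing w u = (u *m w^T) 0 0.
Proof.
by rewrite /pairing -[in RHS](trmxK (u *m w^T)) trmx_mul trmxK [in RHS]mxE.
Qed.

Lemma form1_multilinear w :
  multilinear (fun v : 'I_1 -> 'rV[R]_m => pairing w (v 0)).
Proof.
move=> v i c x y; rewrite !ord1 /upd /= /pairing.
by rewrite linearD linearZ mulmxDr -scalemxAr !mxE.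
Qed.

Lemma form1_killed_by w u : pairing w u = 0 ->
  killed_by u (fun v : 'I_1 -> 'rV[R]_m => pairing w (v 0)).
Proof. by move=> wu v i; rewrite ord1 => ->. Qed.

Lemma ord2_cases (i : 'I_2) : i = 0 \/ i = 1.
Proof.
by case: i => [[|[|//]] ?]; [left|right]; apply: val_inj.
Qed.

Lemma form2_multilinear W :
  multilinear (fun v : 'I_2 -> 'rV[R]_m => bilin W (v 0) (v 1)).
Proof.
move=> v i c x y; rewrite /bilin /upd.
case: (ord2_cases i) => -> /=.
  by rewrite !mulmxDl -!scalemxAl !mxE.
by rewrite linearD linearZ mulmxDr -scalemxAr !mxE.
Qed.

Lemma form2_killed_by W u : W^T = - W -> u *m W = 0 ->
  killed_by u (fun v : 'I_2 -> 'rV[R]_m => bilin W (v 0) (v 1)).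
Proof.
move=> aW uW v i; rewrite /bilin; case: (ord2_cases i) => -> ->.
  by rewrite uW mul0mx mxE.
rewrite -mulmxA -[W]trmxK aW -trmx_mul mulmxN uW oppr0.
by rewrite trmx0 mulmx0 mxE.
Qed.

Lemma wedge_pow_multilinear (f : @ext R 'rV[R]_m 2) n :
  multilinear f -> multilinear (wedge_pow f n).
Proof.
by move=> mf; elim: n => [|n IH] /=; [move=> v [] | exact: (@wedge_multilinear _ _ 2 n.*2)].
Qed.

Lemma wedge_pow_killed_by u (f : @ext R 'rV[R]_m 2) n :
  killed_by u f -> killed_by u (wedge_pow f n).
Proof.
by move=> uf; elim: n => [|n IH] /=; [move=> v [] | exact: (@wedge_killed_by _ _ u 2 n.*2)].
Qed.

End Rank.

(** Each term of w /\ W^n has, for every argument, a factor w or W evaluated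
    on it; so a vector killed by both w and W kills this form, which is of
    top degree and nonzero. *)
Lemma ker_meet_eq0 (R : realType) (n : nat) (M : smoothManifold R n.*2.+1)
    (w : form1 M) (W : form2 M) (p : M) (u : 'rV[R]_n.*2.+1) :
  (W p)^T = - W p -> (exists v, omega_wedge_Omega_pow w W p v != 0) ->
  pairing (w p) u = 0 -> u *m W p = 0 -> u = 0.
Proof.
move=> aW [v Fv] wu uW; apply/eqP; apply: contraNT Fv => u0; apply/eqP.
apply: (@killed_top_form R n.*2.+1 _ u _ _ _ u0).
- apply: (@wedge_multilinear R _ 1 n.*2); first exact: form1_multilinear.
  exact/wedge_pow_multilinear/form2_multilinear.
- exact: (@wedge_antisymmetric R _ 1 n.*2).
- apply: (@wedge_killed_by R _ u 1 n.*2); first exact: form1_killed_by.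
  exact/wedge_pow_killed_by/form2_killed_by.
Qed.

(** * Lie derivatives in coordinates *)

Section Coordinates.
Context {R : realType} {m : nat}.
Notation rV := 'rV[R]_m.
Implicit Types (x v : rV) (E Z w : rV -> rV) (W L : rV -> 'M[R]_m) (h : rV -> R).

(** These coordinate expressions are, at the base point of a chart, the
    right-hand sides that define the differential and the Lie derivatives on
    the manifold. *)
Definition coord_diff h x : rV := \row_k 'D_(delta_mx 0 k) h x.

Definition coord_lie_form1 E w x : rV :=
  'D_(E x) w x + w x *m ('J E x)^T.

Definition coord_lie_bivector E L x : 'M[R]_m :=
  'D_(E x) L x - ('J E x)^T *m L x - L x *m 'J E x.

Definition wedge_vec (u v : rV) : 'M[R]_m := u^T *m v - v^T *m u.

Lemma derive_scalemx {a b : nat} h (F : rV -> 'M[R]_(a, b)) x v :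
  differentiable h x -> differentiable F x ->
  'D_v (fun y => h y *: F y) x = 'D_v h x *: F x + h x *: 'D_v F x.
Proof.
move=> dh dF; have dFe i j : derivable (fun y => F y i j) x v.
  by apply: diff_derivable; have /differentiable_mxP := dF.
have hF i j : (fun y => (h y *: F y) i j) = h * (fun y => F y i j).
  by apply/funext => y; rewrite mxE.
apply/matrixP => i j; rewrite derive_mxE; last first.
  apply/differentiable_mxP => k l; rewrite hF.
  by apply: differentiableM => //; move: k l; apply/differentiable_mxP.
rewrite hF deriveM; [|exact: diff_derivable|exact: dFe].
by rewrite !mxE derive_mxE // addrC; congr (_ + _); exact: mulrC.
Qed.

Lemma differentiable_scalemx {a b : nat} h (F : rV -> 'M[R]_(a, b)) x :
  differentiable h x -> differentiable F x ->
  differentiable (fun y => h y *: F y) x.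
Proof.
move=> dh dF; apply/differentiable_mxP => k l.
under eq_fun do rewrite mxE.
by apply: differentiableM => //; move: k l; apply/differentiable_mxP.
Qed.

Lemma row_jacobian (F : rV -> rV) x k : differentiable F x ->
  row k ('J F x) = 'D_(delta_mx 0 k) F x.
Proof. by move=> dF; rewrite rowE deriveEjacobian. Qed.

Lemma jacobianD_scale Z E h x :
  differentiable Z x -> differentiable E x -> differentiable h x ->
  'J (fun y => Z y + h y *: E y) x
    = 'J Z x + h x *: 'J E x + (coord_diff h x)^T *m E x.
Proof.
move=> dZ dE dh; have dhE := differentiable_scalemx dh dE.
apply/row_matrixP => k.
rewrite row_jacobian; last exact: differentiableD.
rewrite (_ : (fun y => _) = Z + (fun y => h y *: E y)) //.
rewrite deriveD; [|exact: diff_derivable..].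
rewrite derive_scalemx //; apply/rowP => j.
rewrite !mxE big_ord1 !mxE (deriveE _ dZ) (deriveE _ dE).
by rewrite addrA addrAC.
Qed.

(** L_{hE} L = h L_E L - E /\ (dh)^sharp: the differential of h enters through
    the Jacobian of hE, which has the extra term dh^T E, and the two terms in
    which the Jacobian occurs assemble into a wedge product because L is
    antisymmetric. *)
Lemma lie_bivector_scale Z E L h x :
  differentiable Z x -> differentiable E x -> differentiable h x ->
  differentiable L x -> (L x)^T = - L x ->
  coord_lie_bivector (fun y => Z y + h y *: E y) L x
    = coord_lie_bivector Z L x + h x *: coord_lie_bivector E L x
      - wedge_vec (E x) (coord_diff h x *m L x).
Proof.
move=> dZ dE dh dL aL; rewrite /coord_lie_bivector jacobianD_scale //.
have -> : 'D_(Z x + h x *: E x) L x = 'D_(Z x) L x + h x *: 'D_(E x) L x.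
  by rewrite !(deriveE _ dL) linearD linearZ.
have -> : wedge_vec (E x) (coord_diff h x *m L x)
    = (E x)^T *m coord_diff h x *m L x + L x *m ((coord_diff h x)^T *m E x).
  by rewrite /wedge_vec trmx_mul aL mulNmx mulNmx opprK !mulmxA.
rewrite [(_ + _ + _ *m _)^T]linearD /= [(_ + _)^T]linearD /= [(_ *: _)^T]linearZ /=.
rewrite trmx_mul trmxK !mulmxDl !mulmxDr -!scalemxAl -!scalemxAr !scalerBr.
move: ('D_(Z x) L x) ('D_(E x) L x) => DZ DE.
move: ((E x)^T *m _ *m _) (L x *m ((coord_diff h x)^T *m E x)) => P1 P2.
move: (h x *: (_ *m L x)) (h x *: (L x *m _)) (h x *: DE) => Q1 Q2 Q3.
move: (_ *m L x) (L x *m _) => S1 S2.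
by apply/matrixP => i j; rewrite !mxE; ring.
Qed.

(** The index computation behind L_E W = i_E dW + d(i_E W): D a stands for
    the partial derivative of W in the direction a, and J for the Jacobian of
    E times W. *)
Lemma contract_closed (e : rV) (D : 'I_m -> 'M[R]_m) (J : 'M[R]_m) :
  (forall a, (D a)^T = - D a) ->
  (forall a b c, D a b c + D b c a + D c a b = 0) ->
  (forall b, row b J = - (e *m D b)) ->
  \sum_a e 0 a *: D a + J - J^T = 0.
Proof.
move=> aD clD JD; apply/matrixP => b c.
have JE k l : J k l = - \sum_a e 0 a * D k a l.
  by have /rowP/(_ l) := JD k; rewrite !mxE.
have sum0 : \sum_a e 0 a * (D a b c + D b c a + D c a b) = 0.
  by rewrite big1 // => a _; rewrite clD mulr0.
have Dca a : D b c a = - D b a c by have /matrixP/(_ a c) := aD b; rewrite !mxE.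
rewrite mxE [in LHS]mxE summxE [(- J^T) b c]mxE [J^T b c]mxE !JE opprK -sumrN.
rewrite [RHS]mxE -[RHS]sum0 -!big_split /=.
apply: eq_bigr => a _; rewrite Dca !mulrDr mulrN.
by congr (_ + _ + _); rewrite mxE.
Qed.

(** L_E W = 0 for a closed W with i_E W = 0, by Cartan's formula. *)
Lemma lie_closed_form2 E W x :
  differentiable E x -> differentiable W x ->
  (\forall y \near x, (W y)^T = - W y) ->
  (\forall y \near x, E y *m W y = 0) ->
  (forall a b c, 'D_(delta_mx 0 a) W x b c + 'D_(delta_mx 0 b) W x c a
                 + 'D_(delta_mx 0 c) W x a b = 0) ->
  'D_(E x) W x + 'J E x *m W x + W x *m ('J E x)^T = 0.
Proof.
move=> dE dW aW EW clW.
have aDW k : ('D_(delta_mx 0 k) W x)^T = - 'D_(delta_mx 0 k) W x.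
  by rewrite -derive_trmx // (near_eq_derive _ aW) deriveN //; exact: diff_derivable.
have JW b : row b ('J E x *m W x) = - (E x *m 'D_(delta_mx 0 b) W x).
  (* differentiate E W = 0 in the direction b *)
  apply/eqP; rewrite -addr_eq0 row_mul row_jacobian // -derive_mulmx //.
  by rewrite (near_eq_derive _ EW) derive_cst.
have -> : W x *m ('J E x)^T = - ('J E x *m W x)^T.
  by rewrite trmx_mul (nbhs_singleton aW) mulNmx opprK.
have -> : 'D_(E x) W x = \sum_a E x 0 a *: 'D_(delta_mx 0 a) W x.
  rewrite [in LHS](row_sum_delta (E x)) deriveE // linear_sum /=.
  by apply: eq_bigr => a _; rewrite linearZ /= deriveE.
exact: (contract_closed (D := fun a => 'D_(delta_mx 0 a) W x)) aDW clW JW.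
Qed.

(** L_E L = - E /\ (L_E w)^sharp for the Reeb field E. The Lie derivative of
    W L = 1 - w^T E along E, with L_E W = 0 and L_E E = 0, gives
    W (L_E L) = - (L_E w)^T E; that of w L = 0 gives
    w (L_E L) = - (L_E w) L. These two determine L_E L because
    1 = L W + E^T w. *)
Lemma lie_reeb E w W L x :
  differentiable E x -> differentiable w x ->
  differentiable W x -> differentiable L x ->
  (\forall y \near x, (W y)^T = - W y) ->
  (\forall y \near x, (L y)^T = - L y) ->
  (\forall y \near x, E y *m W y = 0) ->
  (\forall y \near x, w y *m L y = 0) ->
  (\forall y \near x, W y *m L y = 1%:M - (w y)^T *m E y) ->
  (forall a b c, 'D_(delta_mx 0 a) W x b c + 'D_(delta_mx 0 b) W x c a
                 + 'D_(delta_mx 0 c) W x a b = 0) ->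
  coord_lie_bivector E L x = - wedge_vec (E x) (coord_lie_form1 E w x *m L x).
Proof.
move=> dE dw dW dL naW naL nEW nwL nWL clW.
have lieW := lie_closed_form2 dE dW naW nEW clW.
have [aW aL] := (nbhs_singleton naW, nbhs_singleton naL).
have [wL WL] := (nbhs_singleton nwL, nbhs_singleton nWL).
have DwL : 'D_(E x) w x *m L x + w x *m 'D_(E x) L x = 0.
  by rewrite -derive_mulmx // (near_eq_derive _ nwL) derive_cst.
have DWL : 'D_(E x) W x *m L x + W x *m 'D_(E x) L x
    = - (('D_(E x) w x)^T *m E x + (w x)^T *m (E x *m 'J E x)).
  rewrite -derive_mulmx // (near_eq_derive _ nWL).
  have dwE : differentiable (fun y => (w y)^T *m E y) x.
    by apply: differentiable_mulmx => //; exact: differentiable_trmx.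
  rewrite (_ : (fun y => _) = cst 1%:M - (fun y => (w y)^T *m E y)) //.
  rewrite deriveB; [|exact: derivable_cst|exact: diff_derivable].
  rewrite derive_cst sub0r derive_mulmx //; last exact: differentiable_trmx.
  by rewrite derive_trmx // ['D_(E x) E x]deriveEjacobian.
have LW : L x *m W x = 1%:M - (E x)^T *m w x.
  rewrite -[LHS]trmxK trmx_mul aW aL mulNmx mulmxN opprK WL.
  by rewrite linearB /= trmx1 trmx_mul trmxK.
set J := 'J E x in DWL lieW *.
rewrite /coord_lie_bivector /coord_lie_form1 -/J.
set DL := 'D_(E x) L x in DwL DWL *.
set Dw := 'D_(E x) w x in DwL DWL *.
set DW := 'D_(E x) W x in DWL lieW *.
set lieL := DL - _ - _.
have wlieL : w x *m lieL = - ((Dw + w x *m J^T) *m L x).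
  rewrite /lieL !mulmxBr !mulmxA wL mul0mx subr0 mulmxDl opprD.
  by rewrite -[w x *m DL](addKr (Dw *m L x)) DwL addr0.
have WlieL : W x *m lieL = - ((Dw + w x *m J^T)^T *m E x).
  have WDL : W x *m DL = - (Dw^T *m E x) - (w x)^T *m (E x *m J) - DW *m L x.
    by rewrite -opprD -DWL addrC addKr.
  have WJL : W x *m J^T *m L x = - (DW *m L x) - (J - J *m (w x)^T *m E x).
    have -> : W x *m J^T = - (DW + J *m W x).
      by apply/eqP; rewrite -addr_eq0 addrC lieW.
    rewrite mulNmx mulmxDl -(mulmxA J (W x)).
    by rewrite WL mulmxBr mulmx1 !mulmxA opprD.
  rewrite /lieL !mulmxBr !mulmxA WDL WJL WL mulmxBl mul1mx.
  rewrite [(Dw + _)^T]linearD /= trmx_mul trmxK mulmxDl !mulmxA.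
  move: (Dw^T *m E x) (DW *m L x) ((w x)^T *m E x *m J) (J *m _ *m _) => A B C D.
  by apply/matrixP => i j; rewrite !mxE; ring.
have -> : lieL = L x *m (W x *m lieL) + (E x)^T *m (w x *m lieL).
  by rewrite !mulmxA LW mulmxBl mul1mx subrK.
rewrite WlieL wlieL /wedge_vec trmx_mul aL mulNmx !mulmxN mulNmx opprD !mulmxA.
by rewrite !opprK addrC.
Qed.

End Coordinates.

Section Jacobian.
Context {R : realType} {m : nat}.

Lemma jacobian_comp (F G : 'rV[R]_m -> 'rV[R]_m) x :
  differentiable F x -> differentiable G (F x) ->
  'J (G \o F) x = 'J F x *m 'J G (F x).
Proof.
move=> dF dG; have dGF := differentiable_comp dF dG.
apply/row_matrixP => k.
transitivity ('D_(delta_mx 0 k) (G \o F) x); first exact: row_jacobian.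
transitivity ('D_('D_(delta_mx 0 k) F x) G (F x)).
  rewrite (deriveE _ dGF) (diff_comp dF dG) (deriveE _ dG).
  congr ('d G (F x) _).
  by apply: esym; exact: deriveE.
by rewrite (deriveEjacobian _ dG) -(row_jacobian k dF) row_mul.
Qed.

Lemma jacobian_near_id (F : 'rV[R]_m -> 'rV[R]_m) x :
  {near x, F =1 id} -> 'J F x = 1%:M.
Proof.
move=> nid; have dF : differentiable F x.
  apply: (near_eq_differentiable (f := id)); last exact: ex_diff.
  by apply: filterS nid => y /= ->.
apply/row_matrixP => k; rewrite row_jacobian // (near_eq_derive _ nid).
by rewrite derive_id row1.
Qed.

End Jacobian.

(** * Tensors in charts *)

Section Charts.
Context {R : realType} {m : nat} {M : smoothManifold R m}.
Implicit Types (i j : chart M) (p q : M) (x : 'rV[R]_m).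

Lemma bwdP i x : (fwd i @` dom i) x -> dom i (bwd i x) /\ fwd i (bwd i x) = x.
Proof. by move=> [q iq <-]; rewrite fwdK. Qed.

Lemma trans_id i q : dom i q -> trans i i q = 1%:M.
Proof.
move=> iq; have Ux : (fwd i @` dom i) (fwd i q) by exists q.
apply: jacobian_near_id; apply: (near_eq_on (@codom_open _ _ _ i) _ Ux) => y Uy /=.
by have [] := bwdP Uy.
Qed.

(** The chain rule for two mutually inverse transition maps. *)
Lemma transK i j q : dom i q -> dom j q -> trans i j q *m trans j i q = 1%:M.
Proof.
move=> iq jq; set x := fwd i q.
have Ux : (fwd i @` dom i) x by exists q.
have xq : bwd i x = q by exact: fwdK.
have near_j : \forall y \near x, (dom j) (bwd i y).
  by apply: (bwd_continuous Ux); rewrite xq; apply: open_nbhs_nbhs; split => //;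
    exact: dom_open.
have nid : {near x, (fwd i \o bwd j) \o (fwd j \o bwd i) =1 id}.
  have : \forall y \near x, (fwd i @` dom i) y.
    by apply: open_nbhs_nbhs; split => //; exact: codom_open.
  apply: filterS2 near_j => y jy Uy /=.
  by rewrite fwdK //; have [] := bwdP Uy.
have dij : differentiable (fwd j \o bwd i) x.
  by have [+ _] := transition_smooth i j 1; apply; exists q.
have xE : fwd j q = (fwd j \o bwd i) x by rewrite /= xq.
rewrite /trans -/x xE -jacobian_comp //; first exact: jacobian_near_id.
rewrite -xE.
by have [+ _] := transition_smooth j i 1; apply; exists q.
Qed.

(** The components of a tensor at a point of a chart differ from those in the
    preferred chart at that point by the matrices trans and their inverses, so
    pointwise tensor identities hold verbatim for the components in any
    chart. *)
Section AtPoint.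
Variables (i : chart M) (x : 'rV[R]_m).
Hypothesis Ux : (fwd i @` dom i) x.

Lemma frameK : trans (chart_at (bwd i x)) i (bwd i x)
  *m trans i (chart_at (bwd i x)) (bwd i x) = 1%:M.
Proof. by apply: transK; [exact: dom_chart_at|have [] := bwdP Ux]. Qed.

Lemma frameVK : trans i (chart_at (bwd i x)) (bwd i x)
  *m trans (chart_at (bwd i x)) i (bwd i x) = 1%:M.
Proof. by apply: transK; [have [] := bwdP Ux|exact: dom_chart_at]. Qed.

Lemma vfield_in_flat (X : vfield M) (W : form2 M) :
  vfield_in i X x *m form2_in i W x = form1_in i (fun q => flat_at (W q) (X q)) x.
Proof.
rewrite /vfield_in /form2_in /form1_in /flat_at.
move: (trans _ i _) (trans i _ _) frameK => T S TS.
move: (X _) (W _) => a A.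
by rewrite !mulmxA -(mulmxA a T S) TS mulmx1.
Qed.

Lemma form1_in_sharp (a : form1 M) (L : bivector M) :
  form1_in i a x *m bivector_in i L x = vfield_in i (sharp L a) x.
Proof.
rewrite /vfield_in /bivector_in /form1_in /sharp /sharp_at.
move: (trans _ i _) (trans i _ _) frameK => T S TS.
move: (a _) (L _) => b A.
by rewrite !mulmxA -(mulmxA b S^T T^T) -trmx_mul TS trmx1 mulmx1.
Qed.

Lemma form1_in_pairing (w : form1 M) (X : vfield M) :
  pairing (form1_in i w x) (vfield_in i X x) = pairing (w (bwd i x)) (X (bwd i x)).
Proof.
rewrite !pairingE /vfield_in /form1_in.
move: (trans _ i _) (trans i _ _) frameK => T S TS.
move: (w _) (X _) => b v.
by rewrite trmx_mul trmxK !mulmxA -(mulmxA v T S) TS mulmx1.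
Qed.

Lemma form2_in_bivector_in (W : form2 M) (L : bivector M) (w : form1 M)
    (E : vfield M) :
  W (bwd i x) *m L (bwd i x) = 1%:M - (w (bwd i x))^T *m E (bwd i x) ->
  form2_in i W x *m bivector_in i L x
    = 1%:M - (form1_in i w x)^T *m vfield_in i E x.
Proof.
rewrite /vfield_in /form1_in /form2_in /bivector_in.
move: (trans _ i _) (trans i _ _) frameK frameVK => T S TS ST.
move: (w _) (E _) (W _) (L _) => b v A B AB.
rewrite !mulmxA -(mulmxA _ S^T T^T) -trmx_mul TS trmx1 mulmx1 -(mulmxA S A B) AB.
by rewrite mulmxBr mulmxBl mulmx1 ST trmx_mul trmxK !mulmxA.
Qed.

End AtPoint.

Lemma form2_in_antisym i (W : form2 M) x : (forall p, (W p)^T = - W p) ->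
  (form2_in i W x)^T = - form2_in i W x.
Proof.
by move=> aW; rewrite /form2_in !trmx_mul trmxK aW mulNmx mulmxN mulmxA.
Qed.

Lemma bivector_in_antisym i (L : bivector M) x : (forall p, (L p)^T = - L p) ->
  (bivector_in i L x)^T = - bivector_in i L x.
Proof.
by move=> aL; rewrite /bivector_in !trmx_mul trmxK aL mulNmx mulmxN mulmxA.
Qed.

Lemma vfield_in_chart_at (X : vfield M) p :
  vfield_in (chart_at p) X (fwd (chart_at p) p) = X p.
Proof.
by rewrite /vfield_in fwdK ?trans_id ?mulmx1 //; exact: dom_chart_at.
Qed.

Lemma bivector_in_chart_at (L : bivector M) p :
  bivector_in (chart_at p) L (fwd (chart_at p) p) = L p.
Proof.
by rewrite /bivector_in fwdK ?trans_id ?trmx1 ?mulmx1 ?mul1mx //;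
  exact: dom_chart_at.
Qed.

Lemma chart_at_mem p :
  (fwd (chart_at p) @` dom (chart_at p)) (fwd (chart_at p) p).
Proof. by exists p => //; exact: dom_chart_at. Qed.

(** In a chart, a contraction of tensor fields is a product of matrices of
    components, so contractions of smooth fields are smooth. *)
Lemma smooth_flat (X : vfield M) (W : form2 M) :
  smooth_vfield X -> smooth_form2 W ->
  smooth_form1 (fun q => flat_at (W q) (X q)).
Proof.
move=> sX [_ sW] i k; have Uo := @codom_open _ _ _ i.
apply: (class_C_eq Uo _ (class_C_mulmx Uo (sX i k) (sW i k))) => x Ux.
exact: vfield_in_flat.
Qed.

Lemma smooth_sharp (a : form1 M) (L : bivector M) :
  smooth_form1 a -> smooth_bivector L -> smooth_vfield (sharp L a).
Proof.
move=> sa [_ sL] i k; have Uo := @codom_open _ _ _ i.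
apply: (class_C_eq Uo _ (class_C_mulmx Uo (sa i k) (sL i k))) => x Ux.
exact: form1_in_sharp.
Qed.

Lemma smooth_pairing (w : form1 M) (X : vfield M) :
  smooth_form1 w -> smooth_vfield X -> smooth_fun (fun q => pairing (w q) (X q)).
Proof.
move=> sw sX i k; have Uo := @codom_open _ _ _ i.
have /(class_C_mxP Uo)/(_ 0 0) :=
  class_C_mulmx Uo (sw i k) (class_C_trmx Uo (sX i k)).
by apply: class_C_eq => // x Ux; exact: form1_in_pairing.
Qed.

End Charts.

(** Flat followed by sharp is the projection along E onto ker w. The rows of
    the difference of the two sides are killed by both w and W, hence
    vanish. *)
Lemma flat_sharpE (R : realType) (n : nat) (M : smoothManifold R n.*2.+1)
    (w : form1 M) (W : form2 M) (E : vfield M) (L : bivector M) (p : M) :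
  regular_acc w W -> dual_pair w W E L ->
  W p *m L p = 1%:M - (w p)^T *m E p.
Proof.
move=> [_ [aW _] _ vol] [_ [aL _] _ sharpK wE EW wL].
have {}wL : L p *m (w p)^T = 0.
  rewrite -[LHS]trmxK trmx_mul trmxK aL mulmxN.
  by have := wL p; rewrite /sharp_at => ->; rewrite oppr0 trmx0.
apply/row_matrixP => k; set v := delta_mx 0 k : 'rV[R]_n.*2.+1.
rewrite !rowE -/v; apply/eqP; rewrite -subr_eq0; apply/eqP.
rewrite mulmxBr mulmx1 mulmxA.
have vw : v *m ((w p)^T *m E p) = (v *m (w p)^T) 0 0 *: E p.
  by rewrite mulmxA [in LHS](mx11_scalar (v *m _)) mul_scalar_mx.
apply: (ker_meet_eq0 (aW p) (vol p)).
  rewrite pairingE !mulmxBl -!mulmxA wL !mulmx0 sub0r.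
  have -> : E p *m (w p)^T = 1%:M.
    by rewrite [LHS]mx11_scalar -pairingE wE.
  by rewrite mulmx1 subrr oppr0 mxE.
rewrite vw !mulmxBl -scalemxAl.
have -> : E p *m W p = 0 by exact: EW.
have -> : v *m W p *m L p *m W p = v *m W p.
  by apply: sharpK; rewrite inE; exists v.
by rewrite scaler0 subr0 subrr.
Qed.

(** * Infinitesimal symmetries of the bivector field *)

Section Symmetries.
Context {R : realType} {n : nat} {M : smoothManifold R n.*2.+1}.
Variables (w : form1 M) (W : form2 M) (E : vfield M) (L : bivector M).
Hypotheses (hreg : regular_acc w W) (hdual : dual_pair w W E L).

Lemma lie_reeb_bivector p :
  lie_bivector E L p = - wedge_vfield E (sharp L (lie_form1 E w)) p.
Proof.
case: (hreg) => sw [aW sW] clW _; case: (hdual) => sE [aL sL] _ _ wE EW wL.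
set i := chart_at p; set x := fwd i p; have Ux := chart_at_mem p.
have near_chart (P : 'rV[R]_n.*2.+1 -> Prop) :
    (forall y, (fwd i @` dom i) y -> P y) -> \forall y \near x, P y.
  move=> HP; apply: (filterS HP); apply: open_nbhs_nbhs.
  by split => //; exact: codom_open.
have dE : differentiable (vfield_in i E) x by have [+ _] := sE i 1; apply.
have dw : differentiable (form1_in i w) x by have [+ _] := sw i 1; apply.
have dW : differentiable (form2_in i W) x by have [+ _] := sW i 1; apply.
have dL : differentiable (bivector_in i L) x by have [+ _] := sL i 1; apply.
have EWi : \forall y \near x, vfield_in i E y *m form2_in i W y = 0.
  apply: near_chart => y Uy; rewrite vfield_in_flat // /form1_in EW.
  by rewrite mul0mx.
have wLi : \forall y \near x, form1_in i w y *m bivector_in i L y = 0.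
  apply: near_chart => y Uy; rewrite form1_in_sharp // /vfield_in /sharp wL.
  by rewrite mul0mx.
have WLi : \forall y \near x, form2_in i W y *m bivector_in i L y
    = 1%:M - (form1_in i w y)^T *m vfield_in i E y.
  apply: near_chart => y Uy; apply: form2_in_bivector_in => //.
  exact: flat_sharpE.
have aWi : \forall y \near x, (form2_in i W y)^T = - form2_in i W y.
  by apply: near_chart => y _; exact: form2_in_antisym.
have aLi : \forall y \near x, (bivector_in i L y)^T = - bivector_in i L y.
  by apply: near_chart => y _; exact: bivector_in_antisym.
have := lie_reeb dE dw dW dL aWi aLi EWi wLi WLi (clW p).
by rewrite vfield_in_chart_at bivector_in_chart_at.
Qed.

(** The left-hand side of the condition on (alpha, h) is L_X L itself, for
    X = alpha^sharp + h E. *)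
Lemma lie_field_Xah (a : form1 M) (h : M -> R) p :
  smooth_form1 a -> smooth_fun h ->
  lie_bivector (field_Xah E L a h) L p
    = schouten (sharp L a) L p
      - wedge_vfield E (sharp L (fun q => dfun h q + h q *: lie_form1 E w q)) p.
Proof.
move=> sa sh; case: (hdual) => sE bL _ _ _ _ _; have [aL sL] := bL.
set i := chart_at p; set x := fwd i p; have Ux := chart_at_mem p.
have dZ : differentiable (vfield_in i (sharp L a)) x.
  by have [+ _] := smooth_sharp sa bL i 1; apply.
have dE : differentiable (vfield_in i E) x by have [+ _] := sE i 1; apply.
have dh : differentiable (fun_in i h) x by have [+ _] := sh i 1; apply.
have dL : differentiable (bivector_in i L) x by have [+ _] := sL i 1; apply.
have := lie_bivector_scale dZ dE dh dL (bivector_in_antisym i x aL).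
have -> : (fun y => vfield_in i (sharp L a) y + fun_in i h y *: vfield_in i E y)
    = vfield_in i (field_Xah E L a h).
  by apply/funext => y; rewrite /vfield_in /field_Xah mulmxDl scalemxAl.
rewrite -[LHS]/(lie_bivector (field_Xah E L a h) L p) => ->.
rewrite -[coord_lie_bivector (vfield_in i E) _ _]/(lie_bivector E L p).
rewrite lie_reeb_bivector vfield_in_chart_at bivector_in_chart_at.
rewrite /fun_in fwdK; last exact: dom_chart_at.
rewrite -[coord_lie_bivector _ _ _]/(schouten (sharp L a) L p).
rewrite -addrA; congr (_ + _).
have sharpE : sharp L (fun q => dfun h q + h q *: lie_form1 E w q) p
    = dfun h p *m L p + h p *: (lie_form1 E w p *m L p).
  by rewrite /sharp /sharp_at mulmxDl scalemxAl.
rewrite -[coord_diff _ x]/(dfun h p) /wedge_vfield sharpE /wedge_vec /sharp /sharp_at.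
move: (E p) (dfun h p *m L p) (lie_form1 E w p *m L p) => e s t.
rewrite [(s + _)^T]linearD /= [(_ *: t)^T]linearZ /= mulmxDr mulmxDl.
rewrite -scalemxAl -scalemxAr.
move: (e^T *m _) (s^T *m _) (e^T *m _) (t^T *m _) => A B C D.
by apply/matrixP => k l; rewrite !mxE; ring.
Qed.

End Symmetries.

Theorem theorem2p8 (R : realType) (n : nat) (M : smoothManifold R n.*2.+1)
    (omega : form1 M) (Omega : form2 M) (E : vfield M) (Lambda : bivector M)
    (hreg : regular_acc omega Omega)
    (hdual : dual_pair omega Omega E Lambda)
    (X : vfield M) (hX : smooth_vfield X) :
  (forall p, lie_bivector X Lambda p = 0) <->
  (exists (alpha : form1 M) (h : M -> R),
    [/\ smooth_form1 alpha, smooth_fun h,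
        forall p, X p = field_Xah E Lambda alpha h p &
        forall p,
          schouten (sharp Lambda alpha) Lambda p
          - wedge_vfield E
              (sharp Lambda
                 (fun q => dfun h q + h q *: lie_form1 E omega q)) p = 0]).
Proof.
split=> [LX|[alpha [h [sa sh /funext -> eq]]] p]; last first.
  by rewrite (lie_field_Xah hreg hdual).
pose alpha : form1 M := fun q => flat_at (Omega q) (X q).
pose h q := pairing (omega q) (X q).
have sa : smooth_form1 alpha by apply: smooth_flat => //; exact: acc_smooth2 hreg.
have sh : smooth_fun h by apply: smooth_pairing => //; exact: acc_smooth1 hreg.
have XE p : X p = field_Xah E Lambda alpha h p.
  rewrite /field_Xah /sharp /sharp_at /flat_at -mulmxA (flat_sharpE p hreg hdual).
  rewrite mulmxBr mulmx1 mulmxA [X p *m _]mx11_scalar -pairingE mul_scalar_mx.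
  by rewrite subrK.
exists alpha, h; split => // p.
by rewrite -(lie_field_Xah hreg hdual) //; have /funext <- := XE.
Qed.
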